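(* Let $\mathcal H$ be a real Hilbert space and let $f:\mathcal H\to\mathbb R$ be convex and differentiable, with $S:=\operatorname{argmin}_{\mathcal H} f\neq\emptyset$ and $\nabla f$ Lipschitz continuous on bounded subsets of $\mathcal H$. Let $c>0$, $t_0>0$, and let $\beta:[t_0,+\infty[\to\,]0,+\infty[$ be a $\mathcal C^2$ function with $\dot\beta(t)\neq 0$ and $\beta(t)\to+\infty$ as $t\to+\infty$. Suppose that there exists $\mu>0$ such that, for $t>t_0$, $$\max\left(\frac{\dot\beta(t)}{\beta(t)},\,1\right)\le c-\mu,$$ and $$\limsup_{t\to+\infty}\ \frac{1+\dfrac{\dot\beta(t)}{\beta(t)}}{\mu+\dfrac{\ddot\beta(t)}{\dot\beta(t)}-\dfrac{\dot\beta(t)}{\beta(t)}}<+\infty .$$ Let $x:[t_0,+\infty[\to\mathcal H$ be a solution of $$\dot x(t)+\beta(t)\nabla f(x(t))+c\,x(t)=0 .$$ Then $x(t)$ converges strongly, as $t\to+\infty$, to $x^*$, the element of minimum norm of $S$, and there exists $t_1\ge t_0$ such that for $t\ge t_1$ $$f(x(t))-\min_{\mathcal H} f=\mathcal O\left(\frac1{\beta(t)}\right),$$ $$\|x(t)-y(t)\|^2=\mathcal O\left(\frac1{e^{\mu t}}+\frac{\dot\beta(t)}{\beta(t)}\right),$$ $$\|\nabla f(x(t))\|^2=\mathcal O\left(\frac1{\beta(t)}\right).$$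
   Context: For each $t\ge t_0$, $\varphi_t(x):=f(x)+\frac{c}{2\beta(t)}\|x\|^2$ for $x\in\mathcal H$, and $y(t):=\operatorname{argmin}_{\mathcal H}\varphi_t$ is its unique minimizer. $g(t)=\mathcal O(h(t))$ for $t\ge t_1$ means that there is a constant $C>0$ with $g(t)\le C\,h(t)$ for all $t\ge t_1$. *)

(* Defs.v *)
From HB Require Import structures.
From mathcomp Require Import all_boot all_order all_algebra.
From mathcomp Require Import all_classical all_reals all_analysis.

Set Implicit Arguments.
Unset Strict Implicit.
Unset Printing Implicit Defensive.

Import Order.TTheory GRing.Theory Num.Theory.
Import numFieldNormedType.Exports.

Local Open Scope classical_set_scope.
Local Open Scope ring_scope.

(* A real Hilbert space is a complete normed module H over R : realType,
   together with a positive definite symmetric bilinear form that induces the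
   norm of H. *)
Definition is_inner_product (R : realType) (H : completeNormedModType R)
    (dot : {dot H for (idfun : R -> R)}) : Prop :=
  forall u : H, dot u u = `|u| ^+ 2.

(* The Riesz representative of the Frechet derivative 'd f x; it exists and is
   unique whenever f is differentiable at x. *)
Definition gradient (R : realType) (H : completeNormedModType R)
    (dot : {dot H for (idfun : R -> R)}) (f : H -> R) (x : H) : H :=
  get [set g : H | forall h : H, 'd f x h = dot g h].

Definition argmin (R : realType) (T : Type) (A : set T) (f : T -> R) : set T :=
  [set x | A x /\ forall z, A z -> f x <= f z].

(* Derivative at t relative to the domain D: the increment s - t is restricted
   to s in D, so that it is the one-sided derivative at an endpoint of D. *)
Definition derivable_on (R : realType) (V : normedModType R) (D : set R)
    (f : R -> V) (t : R) : Prop :=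
  cvg ((s - t)^-1 *: (f s - f t) @[s --> within D t^']).

Definition derive_on (R : realType) (V : normedModType R) (D : set R)
    (f : R -> V) (t : R) : V :=
  lim ((s - t)^-1 *: (f s - f t) @[s --> within D t^']).

Definition C2_on (R : realType) (D : set R) (f : R -> R) : Prop :=
  [/\ forall t, D t -> derivable_on D f t,
      forall t, D t -> derivable_on D (derive_on D f) t &
      {within D, continuous (derive_on D (derive_on D f))}].

Definition tikhonov (R : realType) (H : completeNormedModType R)
    (f : H -> R) (c : R) (beta : R -> R) (t : R) (x : H) : R :=
  f x + c / (2 * beta t) * `|x| ^+ 2.

Definition tikhonov_path (R : realType) (H : completeNormedModType R)
    (f : H -> R) (c : R) (beta : R -> R) (t : R) : H :=
  get (argmin setT (tikhonov f c beta t)).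

Definition bigO_from (R : realType) (t1 : R) (g h : R -> R) : Prop :=
  exists2 C : R, 0 < C & forall t, t1 <= t -> g t <= C * h t.

(* Main.v *)
Require Import Defs.
From HB Require Import structures.
From mathcomp Require Import all_boot all_order all_algebra.
From mathcomp Require Import all_classical all_reals all_analysis.
From mathcomp Require Import ring lra.

Set Implicit Arguments.
Unset Strict Implicit.
Unset Printing Implicit Defensive.

Import Order.TTheory GRing.Theory Num.Theory.
Import numFieldNormedType.Exports.

Local Open Scope classical_set_scope.
Local Open Scope ring_scope.

(** Write [e(t) = c / beta(t)], [phi_e(u) = f(u) + e / 2 |u|^2], [y_e] for the
    minimizer of [phi_e], and [r = beta' / beta].  The equation says that [x] is
    a gradient flow, [x' = - beta grad phi_e (x)], of a function that moves with
    time.  The proof follows the energy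
    [G(t) = beta(t) (phi_e(x(t)) - phi_e(y_e))] with [e = e(t)].

    The minimal value of [phi_e] is a differentiable function of [e] with
    derivative [|y_e|^2 / 2] ([is_derive_regularized_min]), so the path [y_e]
    itself never has to be differentiated.  Strong convexity bounds
    [|grad phi_e(x)|^2] below by [2 e] times the gap to the minimum
    ([regularized_gradient_ge]).  Together with [r <= c - mu] this yields
    ([is_derive_energy], [energy_decay])
    [G' <= - (c + mu) G + c r / 2 (|y_e|^2 - |x|^2)],
    and strong convexity also gives [|x - y_e|^2 <= (4 / c) G]
    ([energy_growth]).  Everything follows from these two facts.

    - Since [|y_e|] is at most the norm of any minimizer of [f] and [r] is
      bounded, [G] is bounded; hence [f(x) - min f = O(1 / beta)], and [x] is
      bounded.  On a ball containing [x] and one gradient step from it, the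
      gradient is Lipschitz, so that [|grad f(x)|^2] is at most a multiple of
      [f(x) - min f] ([sqr_gradient_le]).

    - The limit superior condition gives [1 <= K D] for large [t], where
      [D = mu + beta'' / beta' - beta' / beta = mu + r' / r].  A priori it would
      also permit [D <= 0], but [D] is continuous and cannot cross the gap of
      forbidden small positive values, and [D <= 0] forever would force
      [r = O(exp(- mu t))] and a bounded [beta] ([excess_bounded_below]).  Now
      [(exp(mu t) G)' <= K0 exp(mu t) r <= K0 K (exp(mu t) r)'], because
      [(exp(mu t) r)' = exp(mu t) r D]; integrating gives
      [G = O(exp(- mu t) + r)] ([decay_rate]).

    - As [e] decreases to 0, [y_e] converges strongly to the element [x*] of
      minimum norm among the minimizers of [f] ([regularized_argmin_cvg]).
      Comparing [phi_d(y_d)] with [phi_d(x(t))] for a fixed small [d] shows that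
      the lower limit of [|x(t)|] is at least [|y_d|], hence at least [|x*|].
      The forcing term in the inequality for [G] is therefore eventually below
      any positive number, so [G] tends to 0, and [x] tends to [x*] with [y_e].

    Minimizers of strongly convex functions are limits of minimizing sequences
    ([strongly_convex_minimizer]); the same lemma produces the Riesz
    representative behind the gradient. *)

(** * Inner products and strongly convex minimization *)

Section InnerProduct.
Context {R : realType} {H : completeNormedModType R}.
Context {dot : {dot H for (idfun : R -> R)}}.
Hypothesis dotE : is_inner_product dot.
Implicit Types (u v w : H) (a b : R).

Lemma dotC u v : dot u v = dot v u.
Proof. by rewrite (hermC dot) expr0 mul1r. Qed.

Lemma dotDl u v w : dot (u + v) w = dot u w + dot v w.
Proof. exact: linearDl. Qed.

Lemma dotDr u v w : dot w (u + v) = dot w u + dot w v.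
Proof. exact: linearDr. Qed.

Lemma dotZl a u v : dot (a *: u) v = a * dot u v.
Proof. exact: linearZl_LR. Qed.

Lemma dotZr a u v : dot u (a *: v) = a * dot u v.
Proof. exact: linearZr_LR. Qed.

Lemma dotNl u v : dot (- u) v = - dot u v.
Proof. exact: linearNl. Qed.

Lemma dotNr u v : dot u (- v) = - dot u v.
Proof. exact: linearNr. Qed.

Lemma dotBr u v w : dot w (u - v) = dot w u - dot w v.
Proof. by rewrite dotDr dotNr. Qed.

Lemma dotBl u v w : dot (u - v) w = dot u w - dot v w.
Proof. by rewrite dotDl dotNl. Qed.

Lemma sqr_normD u v : `|u + v| ^+ 2 = `|u| ^+ 2 + 2 * dot u v + `|v| ^+ 2.
Proof. by rewrite -!dotE dotDl !dotDr (dotC v u); ring. Qed.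

Lemma dot_le_norm u v : dot u v <= `|u| * `|v|.
Proof.
have [->|u0] := eqVneq u 0; first by rewrite -(scale0r 0) dotZl mul0r mulr_ge0.
have [->|v0] := eqVneq v 0; first by rewrite -(scale0r 0) dotZr mul0r mulr_ge0.
have uv_gt0 : 0 < `|u| * `|v| by rewrite mulr_gt0 ?normr_gt0.
have := dotE (`|v| *: u - `|u| *: v).
rewrite dotBl !dotBr !dotZl !dotZr !dotE (dotC v u) => E.
have : 0 <= (`|u| * `|v|) * (`|u| * `|v| - dot u v).
  have := sqr_ge0 `| `|v| *: u - `|u| *: v |; rewrite -E; nra.
by rewrite pmulr_rge0// subr_ge0.
Qed.

Lemma norm_dot_le u v : `|dot u v| <= `|u| * `|v|.
Proof.
rewrite ler_norml dot_le_norm andbT lerNl -dotNl.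
by rewrite (le_trans (dot_le_norm _ _))// normrN.
Qed.

Lemma sqr_norm_mid u v :
  `|2^-1 *: (u + v)| ^+ 2 =
  (`|u| ^+ 2 + `|v| ^+ 2) / 2 - `|u - v| ^+ 2 / 4.
Proof.
rewrite normrZ exprMn (sqr_normD u v) (sqr_normD u (- v)) dotNr normrN.
by rewrite ger0_norm ?invr_ge0//; field.
Qed.

Lemma cvg_dot (T : Type) (F : set_system T) {FF : Filter F} (p q : T -> H)
    (u v : H) :
  p s @[s --> F] --> u -> q s @[s --> F] --> v ->
  dot (p s) (q s) @[s --> F] --> dot u v.
Proof.
move=> pu qv; apply/cvgrPdist_le => e e0.
have nq : `|q s| @[s --> F] --> `|v| by exact: cvg_norm.
have h1 : `|u - p s| * `|q s| @[s --> F] --> (0 : R).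
  rewrite -[X in _ --> X](mul0r `|v|); apply: cvgM => //; rewrite -(normr0 H) -(subrr u).
  by apply: cvg_norm; apply: cvgB => //; exact: cvg_cst.
have h2 : `|u| * `|v - q s| @[s --> F] --> (0 : R).
  rewrite -[X in _ --> X](mulr0 `|u|); apply: cvgM; first exact: cvg_cst.
  rewrite -(normr0 H) -(subrr v).
  by apply: cvg_norm; apply: cvgB => //; exact: cvg_cst.
have h12 : `|u - p s| * `|q s| + `|u| * `|v - q s| @[s --> F] --> (0 : R).
  by rewrite -[X in _ --> X](addr0 0); apply: cvgD.
move/cvgrPdist_le : h12 => /(_ _ e0).
apply: filterS => s; rewrite sub0r normrN => /(le_trans (ler_norm _)).
apply: le_trans; rewrite [X in `|X|](_ : _ = dot (u - p s) (q s) + dot u (v - q s)).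
  by rewrite (le_trans (ler_normD _ _))// lerD// norm_dot_le.
by rewrite dotBl dotBr; ring.
Qed.

Lemma continuous_sqr_norm : continuous (fun u : H => `|u| ^+ 2).
Proof.
move=> u; apply: (@continuous_comp _ _ _ _ (fun z : R => z ^+ 2)).
  exact: norm_continuous.
exact: exprn_continuous.
Qed.

(** A minimizing sequence is Cauchy: two points whose values are close to the
    infimum have a midpoint whose value would otherwise fall below it. *)
Lemma strongly_convex_minimizer (phi : H -> R) (k m : R) :
  0 < k -> continuous phi -> (forall u, m <= phi u) ->
  (forall u v, phi (2^-1 *: (u + v)) <= (phi u + phi v) / 2 - k * `|u - v| ^+ 2) ->
  exists y, forall z, phi y <= phi z.
Proof.
move=> k0 cphi phim mid.
set I := inf (range phi).
have hI : has_inf (range phi).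
  split; first by exists (phi 0), 0.
  by exists m => _ [u _ <-].
have Ile u : I <= phi u by apply: ge_inf; [exact: hI.2|exists u].
have ex n : exists u, phi u < I + n.+1%:R^-1.
  have n0 : 0 < n.+1%:R^-1 :> R by [].
  have [_ [u _ <-] uI] := inf_adherent n0 hI.
  by exists u.
pose a n := sval (cid (ex n)).
have aP n : phi (a n) < I + n.+1%:R^-1 by rewrite /a; case: cid.
have close u v d : phi u <= I + d -> phi v <= I + d -> `|u - v| ^+ 2 <= d / k.
  move=> ud vd; rewrite ler_pdivlMr// mulrC.
  by have := mid u v; have := Ile (2^-1 *: (u + v)); lra.
have cva : cvg (a n @[n --> \oo]).
  apply/cauchy_cvgP/cauchy_exP => e e0.
  pose d := k * (e / 2) ^+ 2.
  have d0 : 0 < d by rewrite mulr_gt0// exprn_gt0// divr_gt0.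
  near \oo => n; exists (a n).
  suff : \forall p \near \oo, ball (a n) e (a p) by [].
  near=> p; rewrite -ball_normE/=.
  have : `|a n - a p| ^+ 2 <= d / k.
    apply: close; apply: ltW.
    - apply: lt_trans (aP n) _; rewrite ltrD2l.
      by near: n; apply: near_infty_natSinv_lt (PosNum d0).
    - apply: lt_trans (aP p) _; rewrite ltrD2l.
      by near: p; apply: near_infty_natSinv_lt (PosNum d0).
  rewrite /d mulrC mulKf ?gt_eqF// ler_pXn2r ?nnegrE ?divr_ge0 ?(ltW e0)//.
  by move=> /le_lt_trans; apply; rewrite ltr_pdivrMr// ltr_pMr// ltr1n.
exists (lim (a n @[n --> \oo])) => z; apply: le_trans (Ile z).
have cvphi : phi (a n) @[n --> \oo] --> phi (lim (a n @[n --> \oo])).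
  by apply: continuous_cvg => //; exact: cphi.
apply/ler_addgt0Pr => e e0.
apply: (cvgr_to_le cvphi).
near=> n; apply: ltW; apply: lt_trans (aP n) _; rewrite ltrD2l.
by near: n; apply: near_infty_natSinv_lt (PosNum e0).
Unshelve. all: by end_near. Qed.

(** Half of the quadratic growth of a strongly convex function, which is all
    that comparing the minimum with the value at one midpoint yields. *)
Lemma strongly_convex_growth (phi : H -> R) (k : R) (y z : H) :
  (forall u v, phi (2^-1 *: (u + v)) <= (phi u + phi v) / 2 - k * `|u - v| ^+ 2) ->
  (forall u, phi y <= phi u) -> 2 * k * `|z - y| ^+ 2 <= phi z - phi y.
Proof. by move=> mid ymin; have := mid z y; have := ymin (2^-1 *: (z + y)); lra. Qed.

(** First-order optimality along a line: the quadratic [s * a + s^2 * b] has its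
    minimum at [s = 0].  The witness [- a / (b + 1)] is its minimizer up to a
    shift of the denominator that allows [b = 0]. *)
Lemma linear_part_eq0 (a b : R) :
  0 <= b -> (forall s, 0 <= s * a + s ^+ 2 * b) -> a = 0.
Proof.
move=> b0 /(_ (- a / (b + 1))) h; apply/eqP; rewrite -sqrf_eq0 eq_le sqr_ge0 andbT.
have b1 : 0 < b + 1 by lra.
rewrite -oppr_ge0; have : 0 <= - a ^+ 2 * ((b + 1) ^-1 ^+ 2).
  by apply: (le_trans h); rewrite le_eqVlt; apply/orP; left; apply/eqP; field; lra.
by rewrite pmulr_lge0// exprn_gt0// invr_gt0.
Qed.

(** The Riesz representative of [L] is the minimizer of
    [u |-> |u|^2 / 2 - L u], whose Euler equation reads [dot g h = L h]. *)
Lemma riesz_representation (L : {linear H -> R}) :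
  continuous L -> exists g, forall h, L h = dot g h.
Proof.
move=> cL; have [M M0 LM] : exists2 M : R, 0 < M & forall u, `|L u| <= M * `|u| :=
    linear_lipschitz cL.
have LZ a u : L (a *: u) = a * L u by exact: linearZ.
pose phi u : R := `|u| ^+ 2 / 2 - L u.
have [||u|u v|g gmin] := @strongly_convex_minimizer phi (8^-1) (- M ^+ 2 / 2).
- by [].
- move=> u; apply: cvgB; last exact: cL.
  by apply: cvgM; [exact: continuous_sqr_norm|exact: cvg_cst].
- have Lu : L u <= M * `|u| := le_trans (ler_norm _) (LM u).
  have scal (a b : R) : a <= M * b -> - M ^+ 2 / 2 <= b ^+ 2 / 2 - a.
    by have := sqr_ge0 (b - M); lra.
  exact: scal.
- by rewrite /phi sqr_norm_mid LZ linearD; lra.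
exists g => h; apply/esym/eqP; rewrite -subr_eq0; apply/eqP.
apply: (@linear_part_eq0 _ (`|h| ^+ 2 / 2)); first by rewrite divr_ge0 ?sqr_ge0.
move=> s; have := gmin (g + s *: h).
by rewrite /phi sqr_normD linearD LZ dotZr normrZ exprMn real_normK ?num_real//; lra.
Qed.

End InnerProduct.

(** * Gradients of convex functions *)

Section Gradient.
Context {R : realType} {H : completeNormedModType R}.
Context {dot : {dot H for (idfun : R -> R)}}.
Hypothesis dotE : is_inner_product dot.
Variable f : H -> R.
Hypothesis f_convex : convex_function (setT : set (convex_lmodType H)) f.
Hypothesis f_diff : forall x : H, differentiable f x.
Implicit Types u v w : H.

Local Notation grad := (gradient dot f).

Lemma gradientE u w : 'd f u w = dot (grad u) w.
Proof.
have [g gE] := riesz_representation dotE (diff_continuous (f_diff u)).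
by have := @getI _ [set g | forall h, 'd f u h = dot g h] g gE; exact.
Qed.

Lemma convex_comb u v (s : R) : 0 <= s <= 1 ->
  f (s *: u + (1 - s) *: v) <= s * f u + (1 - s) * f v.
Proof.
move=> s01; pose t := Itv01 (andP s01).1 (andP s01).2.
by have := f_convex t (in_setT (u : convex_lmodType H)) (in_setT v).
Qed.

Lemma convex_mid u v : f (2^-1 *: (u + v)) <= (f u + f v) / 2.
Proof.
have h : 0 <= (2^-1 : R) <= 1 by apply/andP; split; lra.
have half : 1 - 2^-1 = 2^-1 :> R by lra.
by have := convex_comb u v h; rewrite half -scalerDr => /le_trans; apply; lra.
Qed.

Lemma convex_gradient_le u v : f u + dot (grad u) (v - u) <= f v.
Proof.
set w := v - u.
have dw : derivable f u w by exact: diff_derivable.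
rewrite -gradientE -deriveE// -lerBrDl.
have /cvg_dnbhs_at_right c0 := dw; apply: (cvgr_to_le c0).
near=> s => /=.
have s0 : 0 < s by [].
have s1 : s <= 1 by near: s; apply: nbhs_right_le.
rewrite -[_ *: _]/(s^-1 * _) ler_pdivrMl//.
have -> : s *: w + u = s *: v + (1 - s) *: u.
  by rewrite /w scalerBr scalerBl scale1r addrAC addrA.
have := @convex_comb v u s; rewrite s1 ltW// => /(_ isT); lra.
Unshelve. all: by end_near. Qed.

(** A gradient step of length [1 / (2 L)] decreases [f] by at least
    [|grad u|^2 / (4 L)], and [f] cannot fall below [m].  Convexity replaces the
    usual integral remainder: the increment is controlled by the gradient at the
    end of the step. *)
Lemma sqr_gradient_le (L m : R) u : 0 < L -> (forall v, m <= f v) ->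
  (let u' := u - (2 * L)^-1 *: grad u in
   `|grad u' - grad u| <= L * `|u' - u|) ->
  `|grad u| ^+ 2 <= 4 * L * (f u - m).
Proof.
move=> L0 fm /=; set g := grad u; set s := (2 * L)^-1; set u' := u - s *: g => lip.
have s0 : 0 < s by rewrite invr_gt0 mulr_gt0.
have u'u : u' - u = - (s *: g) by rewrite /u' addrC addKr.
have := convex_gradient_le u' u; rewrite -opprB dotNr u'u dotNr opprK => h1.
have h2 : dot (grad u') (s *: g) = s * dot (grad u' - g) g + s * `|g| ^+ 2.
  by rewrite dotZr dotBl -dotE -mulrDr subrK.
have h3 : - dot (grad u' - g) g <= L * s * `|g| ^+ 2.
  rewrite -dotNl; apply: le_trans (dot_le_norm dotE _ _) _; rewrite normrN expr2 mulrA.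
  rewrite ler_wpM2r// (le_trans lip)// u'u normrN normrZ gtr0_norm// mulrA//.
have h4 : s * `|g| ^+ 2 - s * (L * s * `|g| ^+ 2) <= f u - m.
  by have := fm u'; have := ler_wpM2l (ltW s0) h3; lra.
have -> : `|g| ^+ 2 = 4 * L * (s * `|g| ^+ 2 - s * (L * s * `|g| ^+ 2)).
  by rewrite /s; field; rewrite gt_eqF.
by rewrite ler_pM2l// mulr_gt0.
Qed.

End Gradient.

Section GradientBound.
Context {R : realType} {H : completeNormedModType R}.
Context {dot : {dot H for (idfun : R -> R)}}.
Hypothesis dotE : is_inner_product dot.
Variable f : H -> R.
Hypothesis f_convex : convex_function (setT : set (convex_lmodType H)) f.
Hypothesis f_diff : forall u : H, differentiable f u.
Hypothesis grad_lip : forall B : set H, bounded_set B ->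
  [lipschitz gradient dot f x | x in B].

Lemma lipschitz_ball (rho : R) : exists2 L : R, 0 < L &
  forall u v : H, `|u| <= rho -> `|v| <= rho ->
  `|gradient dot f u - gradient dot f v| <= L * `|u - v|.
Proof.
have bd : bounded_set [set u : H | `|u| <= rho].
  exists rho; split; first exact: num_real.
  by move=> M rM u /= ur; exact: le_trans ur (ltW rM).
have [L0 [_ lip]] := grad_lip bd.
pose L := Num.max (L0 + 1) 1.
have LL0 : L0 < L by rewrite lt_max ltrDl ltr01.
exists L; first by rewrite lt_max ltr01 orbT.
by move=> u v ur vr; exact: (lip L LL0 (u, v)).
Qed.

(** A gradient step from a ball may leave it, but only by an amount controlled by
    the size of the gradient there; hence the two nested balls. *)
Lemma sqr_gradient_le_on_ball (z0 : H) (rho : R) : (forall z, f z0 <= f z) ->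
  exists2 K : R, 0 < K & forall u : H, `|u| <= rho ->
  `|gradient dot f u| ^+ 2 <= K * (f u - f z0).
Proof.
move=> z0_min.
have [L0 L00 lip0] := lipschitz_ball `|rho|.
pose g0 := `|gradient dot f 0| + L0 * `|rho|.
have g00 : 0 <= g0 by rewrite addr_ge0// mulr_ge0// ltW.
have gb u : `|u| <= rho -> `|gradient dot f u| <= g0.
  move=> ur; have ur' : `|u| <= `|rho| := le_trans ur (ler_norm _).
  have := lip0 u 0 ur'; rewrite normr0 normr_ge0 subr0 => /(_ isT) h.
  rewrite -[gradient dot f u](subrK (gradient dot f 0)) addrC.
  apply: le_trans (ler_normD _ _) _; rewrite lerD2l (le_trans h)//.
  by rewrite ler_wpM2l// ltW.
have [L1 L10 lip1] := lipschitz_ball (rho + g0).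
pose L := L1 + 1; have L1L : L1 <= L by rewrite lerDl.
have L0' : 0 < L by rewrite ltr_wpDl// ltW.
exists (4 * L); first by rewrite mulr_gt0.
move=> u ur; apply: (sqr_gradient_le dotE f_convex f_diff L0' z0_min) => /=.
set u' := u - _; apply: (@le_trans _ _ (L1 * `|u' - u|)); last first.
  by rewrite ler_wpM2r.
have L2 : (2 * L)^-1 <= 1 by rewrite invf_le1 ?mulr_gt0//; rewrite /L; lra.
apply: lip1; last by rewrite (le_trans ur)// lerDl.
apply: le_trans (ler_normB _ _) _; rewrite lerD// normrZ.
rewrite ger0_norm ?invr_ge0 ?mulr_ge0 ?(ltW L0')//.
by rewrite -[leRHS]mul1r ler_pM ?gb// invr_ge0 mulr_ge0// ltW.
Qed.

End GradientBound.

(** * Tikhonov regularization of a convex function *)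

Section Tikhonov.
Context {R : realType} {H : completeNormedModType R}.
Context {dot : {dot H for (idfun : R -> R)}}.
Hypothesis dotE : is_inner_product dot.
Variable f : H -> R.
Hypothesis f_convex : convex_function (setT : set (convex_lmodType H)) f.
Hypothesis f_diff : forall x : H, differentiable f x.
Variable z0 : H.
Hypothesis z0_min : forall z, f z0 <= f z.
Implicit Types (u v z : H) (e d : R).

Definition regularized e u : R := f u + e / 2 * `|u| ^+ 2.

Definition regularized_argmin e : H := get (argmin setT (regularized e)).

Local Notation phi := regularized.
Local Notation y := regularized_argmin.

Lemma f_continuous : continuous f.
Proof. by move=> u; exact: differentiable_continuous. Qed.

Lemma regularized_mid e u v :
  phi e (2^-1 *: (u + v)) <=
  (phi e u + phi e v) / 2 - e / 8 * `|u - v| ^+ 2.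
Proof.
by rewrite /phi (sqr_norm_mid dotE); have := convex_mid f_convex u v; lra.
Qed.

Lemma regularized_argminP e : 0 < e -> forall z, phi e (y e) <= phi e z.
Proof.
move=> e0; have [||||z zmin] :=
    @strongly_convex_minimizer _ _ (phi e) (e / 8) (f z0).
- by rewrite divr_gt0.
- move=> u; apply: cvgD; first exact: f_continuous.
  by apply: cvgM; [exact: cvg_cst|exact: continuous_sqr_norm].
- move=> u; rewrite (le_trans (z0_min u))// lerDl.
  by rewrite mulr_ge0 ?sqr_ge0// divr_ge0// ltW.
- exact: regularized_mid.
have : argmin setT (phi e) (y e) by apply: (@getI _ _ z); split.
by case=> _ h u; exact: h.
Qed.

Lemma regularized_growth e z : 0 < e ->
  e / 4 * `|z - y e| ^+ 2 <= phi e z - phi e (y e).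
Proof.
move=> e0.
have := strongly_convex_growth z (regularized_mid e) (regularized_argminP e0).
lra.
Qed.

Lemma norm_regularized_argmin_le e z : 0 < e -> (forall u, f z <= f u) ->
  `|y e| ^+ 2 <= `|z| ^+ 2.
Proof.
move=> e0 zmin; have := regularized_argminP e0 z; rewrite /phi.
have := zmin (y e) => h1 h2.
have h3 : e / 2 * `|y e| ^+ 2 <= e / 2 * `|z| ^+ 2 by lra.
by move: h3; rewrite ler_pM2l// divr_gt0.
Qed.

(** Testing the minimality of [y d] against [y e] converts the growth of
    [phi e] into a modulus of continuity governed by the squared norms alone. *)
Lemma regularized_argmin_dist e d : 0 < d -> 0 < e ->
  e / 4 * `|y d - y e| ^+ 2 <= (e - d) / 2 * (`|y d| ^+ 2 - `|y e| ^+ 2).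
Proof.
move=> d0 e0; have := regularized_growth (y d) e0.
by have := regularized_argminP d0 (y e); rewrite /phi; lra.
Qed.

Lemma regularized_argmin_dist_le e d : 0 < d -> d < e ->
  `|y d - y e| ^+ 2 <= 2 * (`|y d| ^+ 2 - `|y e| ^+ 2).
Proof.
move=> d0 de; have e0 := lt_trans d0 de.
have h := regularized_argmin_dist d0 e0.
have h0 : 0 <= `|y d| ^+ 2 - `|y e| ^+ 2.
  have : 0 <= (e - d) / 2 * (`|y d| ^+ 2 - `|y e| ^+ 2).
    by apply: le_trans h; rewrite mulr_ge0 ?sqr_ge0// divr_ge0// ltW.
  by rewrite pmulr_rge0// divr_gt0// subr_gt0.
have e4 : 0 < e / 4 by rewrite divr_gt0.
rewrite -(ler_pM2l e4) (le_trans h)//.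
by have := mulr_ge0 (ltW d0) h0; lra.
Qed.

(** As the regularization vanishes, [|y e|^2] increases and stays bounded, so
    [y e] is Cauchy; its limit minimizes [f] and is no longer than any other
    minimizer. *)
Lemma regularized_argmin_cvg : exists z,
  [/\ forall u, f z <= f u,
      forall u, (forall v, f u <= f v) -> `|z| <= `|u| &
      y e @[e --> 0^'+] --> z].
Proof.
pose A := [set `|y d| ^+ 2 | d in [set d : R | 0 < d]].
have hA : has_sup A.
  split; first by exists (`|y 1| ^+ 2); exists 1 => //=.
  by exists (`|z0| ^+ 2) => _ [d /= d0 <-]; exact: norm_regularized_argmin_le.
have ycvg : cvg (y e @[e --> 0^'+]).
  apply/cauchy_cvgP/cauchy_exP => e e0.
  have e20 : 0 < e ^+ 2 / 2 by rewrite divr_gt0// exprn_gt0.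
  have [_ [d /= d0 <-] dA] := sup_adherent e20 hA.
  exists (y d); suff : \forall s \near 0^'+, ball (y d) e (y s) by [].
  near=> s; rewrite -ball_normE/= distrC.
  have s0 : 0 < s by [].
  have sd : s < d by near: s; exact: nbhs_right_lt.
  have sA : `|y s| ^+ 2 <= sup A by apply: ub_le_sup; [exact: hA.2|exists s].
  have := regularized_argmin_dist_le s0 sd => h.
  have : `|y s - y d| ^+ 2 < e ^+ 2 by lra.
  by rewrite ltr_pXn2r ?nnegrE// ltW.
set z := lim _ in ycvg *.
have ycvg' : y e @[e --> 0^'+] --> z by [].
have fcvg : f (y e) @[e --> 0^'+] --> f z.
  by apply: continuous_cvg => //; exact: f_continuous.
have ncvg : `|y e| @[e --> 0^'+] --> `|z| by exact: cvg_norm.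
exists z; split => // u.
- suff : f z <= f u + 0 / 2 * `|u| ^+ 2 by rewrite !mul0r addr0.
  apply: (ler_cvg_to fcvg (g := fun e => f u + e / 2 * `|u| ^+ 2)).
    apply: cvgD; first exact: cvg_cst.
    apply: cvgM; last exact: cvg_cst.
    apply: cvgM; last exact: cvg_cst.
    by apply: cvg_at_right_filter; exact: cvg_id.
  near=> e; have e0 : 0 < e by [].
  have := regularized_argminP e0 u; rewrite /phi => /(le_trans _); apply.
  by rewrite lerDl mulr_ge0 ?sqr_ge0// divr_ge0// ltW.
- move=> umin; apply: (cvgr_to_le ncvg); near=> e; have e0 : 0 < e by [].
  by rewrite -(@ler_pXn2r _ 2) ?nnegrE// norm_regularized_argmin_le.
Unshelve. all: by end_near. Qed.

Lemma min_norm_unique u v :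
  (forall w, f u <= f w) -> (forall w, f v <= f w) ->
  (forall w, (forall w', f w <= f w') -> `|u| <= `|w|) ->
  `|v| <= `|u| -> u = v.
Proof.
move=> um vm un vn; have muv : forall w, f (2^-1 *: (u + v)) <= f w.
  by move=> w; have := convex_mid f_convex u v; have := um w; have := vm w; lra.
have uv : `|u| = `|v| by apply/eqP; rewrite eq_le vn (un _ vm).
have : `|u| ^+ 2 <= `|2^-1 *: (u + v)| ^+ 2 by rewrite ler_pXn2r ?nnegrE// un.
rewrite (sqr_norm_mid dotE) -uv => h.
have : `|u - v| ^+ 2 <= 0 by lra.
rewrite -[leRHS](expr0n R 2) ler_pXn2r ?nnegrE// normr_le0 subr_eq0.
by move/eqP.
Qed.

(** The envelope theorem: [e |-> min (phi e)] is an infimum of affine functions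
    of [e], and [|y e|^2 / 2] is the slope of the one that is active at [e]. *)
Lemma is_derive_regularized_min e : 0 < e ->
  is_derive e 1 (fun s => phi s (y s)) (`|y e| ^+ 2 / 2).
Proof.
move=> e0.
have near_pos : \forall h \near (0 : R)^', 0 < h + e.
  apply: nbhs_dnbhs.
  have : h + e @[h --> (0 : R)] --> 0 + e.
    by apply: cvgD; [exact: cvg_id|exact: cvg_cst].
  by rewrite add0r => /cvgr_gt /(_ _ e0).
have ycont : y (h + e) @[h --> (0 : R)^'] --> y e.
  have sq : `|y (h + e) - y e| ^+ 2 @[h --> (0 : R)^'] --> (0 : R).
    apply: (@squeeze_cvgr _ _ _ _ (fun=> 0)
             (fun h : R => `|h| * (2 / e * `|z0| ^+ 2))); last 2 first.
    - exact: cvg_cst.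
    - rewrite -[X in _ --> X](mul0r (2 / e * `|z0| ^+ 2)); apply: cvgM; last exact: cvg_cst.
      have id0 : h @[h --> (0 : R)^'] --> (0 : R) by move=> A; exact: nbhs_dnbhs.
      by rewrite -[X in _ --> X](normr0 R); apply: cvg_norm.
    near=> h; rewrite sqr_ge0/=.
    have h0 : 0 < h + e by near: h.
    have := regularized_argmin_dist h0 e0.
    have -> : (e - (h + e)) / 2 = - h / 2 by lra.
    have n1 := norm_regularized_argmin_le h0 z0_min.
    have n2 := norm_regularized_argmin_le e0 z0_min.
    have n3 : - h * (`|y (h + e)| ^+ 2 - `|y e| ^+ 2) <= `|h| * `|z0| ^+ 2.
      apply: le_trans (ler_norm _) _; rewrite normrM normrN ler_wpM2l//.
      have := sqr_ge0 `|y (h + e)|; have := sqr_ge0 `|y e|.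
      by rewrite ler_norml; move=> *; apply/andP; split; lra.
    move=> n4; have e4 : 0 < e / 4 by rewrite divr_gt0.
    rewrite -(ler_pM2l e4) (le_trans n4)//.
    have -> : e / 4 * (`|h| * (2 / e * `|z0| ^+ 2)) = `|h| * `|z0| ^+ 2 / 2.
      by field; rewrite gt_eqF.
    lra.
  apply/cvgrPdist_lt => d d0; move/cvgrPdist_lt : sq => /(_ _ (exprn_gt0 2 d0)).
  apply: filterS => h; rewrite sub0r normrN ger0_norm ?sqr_ge0//.
  by rewrite ltr_pXn2r ?nnegrE// 1?distrC// ltW.
have c1 : `|y (h + e)| ^+ 2 / 2 @[h --> (0 : R)^'] --> `|y e| ^+ 2 / 2.
  apply: cvgM; last exact: cvg_cst.
  exact: (cvg_comp _ _ ycont (@continuous_sqr_norm _ _ (y e))).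
have c2 : `|y (h + e)| ^+ 2 / 2 - `|y e| ^+ 2 / 2 @[h --> (0 : R)^'] --> (0 : R).
  by rewrite -[X in _ --> X](subrr (`|y e| ^+ 2 / 2)); apply: cvgB => //; exact: cvg_cst.
suff c : h^-1 *: (phi (h *: 1 + e) (y (h *: 1 + e)) - phi e (y e)) @[h --> (0 : R)^']
    --> `|y e| ^+ 2 / 2.
  by apply: DeriveDef; [apply/cvg_ex; eexists; exact: c|exact: cvg_lim c].
apply/cvgrPdist_le => d d0; move/cvgrPdist_le : c2 => /(_ _ d0).
apply: filter_app; near=> h; rewrite sub0r normrN; apply: le_trans.
have h0 : 0 < h + e by near: h.
have hn : h != 0 by near: h; exact: nbhs_dnbhs_neq.
rewrite [h *: 1]mulr1.
have E1 := regularized_argminP h0 (y e).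
have E2 := regularized_argminP e0 (y (h + e)).
rewrite -(ler_pM2l (_ : 0 < `|h|)) ?normr_gt0// -!normrM mulrBr.
rewrite -[h^-1 *: _]/(h^-1 * _) mulVKf//.
move: E1 E2; rewrite /phi.
move: (f (y e)) (f (y (h + e))) (`|y e| ^+ 2 : R) (`|y (h + e)| ^+ 2 : R) => p q a b.
move=> E1 E2.
set D := q + (h + e) / 2 * b - (p + e / 2 * a).
have D1 : D <= h * (a / 2) by rewrite /D; lra.
have D2 : h * (b / 2) <= D by rewrite /D; lra.
rewrite ler_norml; apply/andP; split.
  by have := normr_ge0 (h * (b / 2 - a / 2)); lra.
by have := ler_norm (- (h * (b / 2 - a / 2))); rewrite normrN; lra.
Unshelve. all: by end_near. Qed.

End Tikhonov.

(** * Differential inequalities on a half-line *)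

Section RealCalculus.
Context {R : realType}.
Implicit Types (a b k t v dg dq : R) (g q : R -> R).

Lemma is_deriveD_fun g q dg dq t : is_derive t 1 g dg -> is_derive t 1 q dq ->
  is_derive t 1 (fun s => g s + q s : R) (dg + dq : R).
Proof. by move=> ? ?; exact: is_deriveD. Qed.

Lemma is_deriveB_fun g q dg dq t : is_derive t 1 g dg -> is_derive t 1 q dq ->
  is_derive t 1 (fun s => g s - q s : R) (dg - dq : R).
Proof. by move=> ? ?; exact: is_deriveB. Qed.

Lemma is_deriveM_fun g q dg dq t : is_derive t 1 g dg -> is_derive t 1 q dq ->
  is_derive t 1 (fun s => g s * q s : R) (dg * q t + g t * dq : R).
Proof.
move=> dg' dh'; apply: is_derive_eq.
by rewrite /GRing.scale/= mulrC addrC; congr (_ + _); rewrite mulrC.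
Qed.

Lemma is_deriveZ_fun k g dg t : is_derive t 1 g dg ->
  is_derive t 1 (fun s => k * g s : R) (k * dg : R).
Proof. by move=> ?; exact: is_deriveZ. Qed.

Lemma is_derive_div_fun g q dg dq t : q t != 0 ->
  is_derive t 1 g dg -> is_derive t 1 q dq ->
  is_derive t 1 (fun s => g s / q s : R) (dg / q t - g t * dq / q t ^+ 2 : R).
Proof.
move=> ht dg' dh'; have dV := is_deriveV ht dh'.
apply: (is_derive_eq (is_deriveM_fun dg' dV)).
by rewrite /GRing.scale/=; field.
Qed.

Lemma is_derive_expRM k t : is_derive t 1 (fun s => expR (k * s)) (k * expR (k * t)).
Proof.
have d : is_derive t 1 (fun s : R => k * s) k.
  by apply: (is_derive_eq (is_deriveZ_fun k (is_derive_id t 1))); rewrite mulr1.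
by apply: (is_derive_eq (is_derive1_comp (is_derive_expR _) d)); rewrite mulrC.
Qed.

Lemma is_derive_continuous (V : normedModType R) (g : R -> V) (dg : V) t :
  is_derive t 1 g dg -> {for t, continuous g}.
Proof.
by case=> h _; apply: differentiable_continuous; apply/derivable1_diffP.
Qed.

Lemma derive_on_interior (V : normedModType R) (g : R -> V) a t : a < t ->
  derivable_on `[a, +oo[ g t -> is_derive t 1 g (derive_on `[a, +oo[ g t).
Proof.
move=> at_ Q; rewrite /derive_on; set l := lim _.
have {}Q : (s - t)^-1 *: (g s - g t) @[s --> within `[a, +oo[ t^'] --> l by [].
suff c : h^-1 *: (g (h *: 1 + t) - g t) @[h --> (0 : R)^'] --> l.
  by apply: DeriveDef; [apply/cvg_ex; exists l|exact: cvg_lim c].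
move=> U lU.
have : \forall s \near t, s != t -> `[a, +oo[%classic s ->
    U ((s - t)^-1 *: (g s - g t)) := Q _ lU.
rewrite (near_shift 0 t) subr0 => N.
suff : \forall h \near (0 : R), h != 0 -> U (h^-1 *: (g (h *: 1 + t) - g t)) by [].
have : \forall h \near (0 : R), a < h + t.
  have : h + t @[h --> (0 : R)] --> 0 + t.
    by apply: cvgD; [exact: cvg_id|exact: cvg_cst].
  by rewrite add0r => /cvgr_gt /(_ _ at_).
apply: filter_app; move: N; apply: filterS => h /= + ath h0.
rewrite -[h *: 1]/(h * 1) mulr1 addrK; apply.
  by rewrite -subr_eq0 addrK.
by rewrite in_itv/= andbT ltW.
Qed.

Lemma derive_le0_nincr g (g' : R -> R) a :
  (forall t, a < t -> is_derive t 1 g (g' t)) -> (forall t, a < t -> g' t <= 0) ->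
  forall s t, a < s -> s <= t -> g t <= g s.
Proof.
move=> d dg0 s t as_ st; apply: (@ler0_derive1_nincry _ g s) => // [r|r|].
- by rewrite in_itv/= andbT => sr; have [] := d _ (lt_trans as_ sr).
- rewrite in_itv/= andbT => sr; have ar := lt_trans as_ sr.
  by rewrite derive1E; have [_ ->] := d _ ar; exact: dg0.
- apply: continuous_in_subspaceT => r; rewrite inE/= in_itv/= andbT => sr.
  exact: is_derive_continuous (d _ (lt_le_trans as_ sr)).
Qed.

(** Integrating factor: [expR (k * t) * (g t - b / k)] is nonincreasing. *)
Lemma gronwall_exp g (g' : R -> R) a k b :
  0 < k -> (forall t, a < t -> is_derive t 1 g (g' t)) ->
  (forall t, a < t -> g' t <= - k * g t + b) ->
  forall s t, a < s -> s <= t ->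
  g t <= b / k + expR (- (k * (t - s))) * (g s - b / k).
Proof.
move=> k0 d dle s t as_ st; pose u r := expR (k * r) * (g r - b / k).
have du r : a < r -> is_derive r 1 u (expR (k * r) * (g' r + k * g r - b)).
  move=> ar; apply: (is_derive_eq (is_deriveM_fun (is_derive_expRM k r)
    (is_deriveB_fun (d r ar) (is_derive_cst (b / k) r 1)))).
  by rewrite /cst subr0; field; rewrite gt_eqF.
have := derive_le0_nincr du _ as_ st; rewrite /u => h.
have {}h : expR (k * t) * (g t - b / k) <= expR (k * s) * (g s - b / k).
  apply: h => r ar; rewrite pmulr_rle0 ?expR_gt0//.
  by have := dle r ar; lra.
rewrite addrC -lerBlDr -(ler_pM2l (expR_gt0 (k * t))) mulrA -expRD.
by rewrite (_ : k * t + - (k * (t - s)) = k * s)//; ring.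
Qed.

Lemma continuous_avoid_lt g a v :
  (forall t, a < t -> {for t, continuous g}) -> (forall t, a < t -> g t != v) ->
  forall s t, a < s -> a < t -> g s < v -> g t < v.
Proof.
move=> cg gv.
have cw s t : a < s -> {within `[s, t], continuous g}.
  move=> as_; apply: continuous_in_subspaceT => r; rewrite inE/= in_itv/= => /andP[sr _].
  exact: cg (lt_le_trans as_ sr).
have key s t : a < s -> s <= t -> (g s < v) = (g t < v).
  move=> as_ st; apply/idP/idP => h; apply: contraT; rewrite -leNgt => h';
    (have [|r] := IVT st (cw s t as_) (v := v);
      first by rewrite ge_min le_max h' (ltW h) ?orbT);
    rewrite in_itv/= => /andP[sr _] grv;
    by have := gv r (lt_le_trans as_ sr); rewrite grv eqxx.
move=> s t as_ at_ gs; have [st|/ltW ts] := leP s t; first by rewrite -(key s t).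
by rewrite (key t s).
Qed.

Lemma limf_esup_lt_pinfty g :
  (limf_esup (fun t => (g t)%:E) (+oo)%R < +oo)%E ->
  exists M, \forall t \near +oo, g t <= M.
Proof.
rewrite limf_esupE => /ereal_inf_lt[_ [V VN <-]] sV.
have [M VM] : exists M : R, forall t, V t -> g t <= M.
  case E : (ereal_sup _) sV => [M| |]// _.
  - exists M => t Vt; rewrite -lee_fin -E; apply: ereal_sup_ubound.
    by exists t.
  - exists 0 => t Vt.
    by have : ((g t)%:E <= -oo)%E by rewrite -E; apply: ereal_sup_ubound; exists t.
by exists M; apply: filterS VN.
Qed.

End RealCalculus.

(** * The energy of the regularized gradient flow *)

Section Dynamics.
Context {R : realType} {H : completeNormedModType R}.
Context {dot : {dot H for (idfun : R -> R)}}.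
Hypothesis dotE : is_inner_product dot.
Variable f : H -> R.
Hypothesis f_convex : convex_function (setT : set (convex_lmodType H)) f.
Hypothesis f_diff : forall u : H, differentiable f u.
Variable z0 : H.
Hypothesis z0_min : forall z, f z0 <= f z.
Implicit Types (e t : R) (u z : H).

Local Notation grad := (gradient dot f).
Local Notation phi := (regularized f).
Local Notation y := (regularized_argmin f).

Lemma is_derive_comp_gradient (x : R -> H) (dx : H) t :
  is_derive t 1 x dx ->
  is_derive t 1 (fun s => f (x s)) (dot (grad (x t)) dx).
Proof.
move=> [dvx dxE]; have xd : differentiable x t by apply/derivable1_diffP.
have fxd : differentiable (f \o x) t by exact: differentiable_comp.
apply: DeriveDef; first exact/derivable1_diffP.
rewrite [LHS](deriveE _ fxd) diff_comp//= -(deriveE _ xd) dxE.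
exact: gradientE.
Qed.

Lemma is_derive_sqr_norm (x : R -> H) (dx : H) t :
  is_derive t 1 x dx ->
  is_derive t 1 (fun s => `|x s| ^+ 2) (2 * dot (x t) dx).
Proof.
move=> dx'; have [dvx dxE] := dx'.
have quot : h^-1 *: (x (h *: 1 + t) - x t) @[h --> (0 : R)^'] --> dx.
  by rewrite -dxE; exact: dvx.
have xc : x (h *: 1 + t) @[h --> (0 : R)^'] --> x t.
  have lin : h *: 1 + t @[h --> (0 : R)^'] --> t.
    have : h + t @[h --> (0 : R)^'] --> 0 + t.
      by apply: cvgD; [move=> A; exact: nbhs_dnbhs|exact: cvg_cst].
    by rewrite add0r; under eq_cvg do rewrite -[X in X + t]mulr1.
  exact: (cvg_comp _ _ lin (is_derive_continuous dx')).
have xc2 : x (h *: 1 + t) + x t @[h --> (0 : R)^'] --> x t + x t.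
  by apply: cvgD => //; exact: cvg_cst.
have c := cvg_dot dotE quot xc2.
have eqf : (fun h => dot (h^-1 *: (x (h *: 1 + t) - x t)) (x (h *: 1 + t) + x t)) =
    (fun h : R => h^-1 *: (`|x (h *: 1 + t)| ^+ 2 - `|x t| ^+ 2)).
  apply/funext => h; rewrite dotZl; congr (_ * _).
  rewrite dotBl !dotDr !dotE (dotC (x t) (x (h *: 1 + t))).
  by rewrite opprD addrA addrK.
have eql : dot dx (x t + x t) = 2 * dot (x t) dx.
  by rewrite dotDr (dotC dx); ring.
have {}c : h^-1 *: (`|x (h *: 1 + t)| ^+ 2 - `|x t| ^+ 2) @[h --> (0 : R)^'] -->
    2 * dot (x t) dx.
  by move: c; rewrite eqf eql; exact.
by apply: DeriveDef; [apply/cvg_ex; eexists; exact: c|exact: cvg_lim c].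
Qed.

(** The Polyak-Lojasiewicz inequality of a strongly convex function. *)
Lemma regularized_gradient_ge e u z : 0 < e ->
  2 * e * (phi e u - phi e z) <= `|grad u + e *: u| ^+ 2.
Proof.
move=> e0; have h1 := convex_gradient_le dotE f_convex f_diff u z.
set w := grad u + e *: u.
have h2 : `|z| ^+ 2 = `|u| ^+ 2 + 2 * dot u (z - u) + `|z - u| ^+ 2.
  by rewrite -(sqr_normD dotE) [u + _]addrC subrK.
have h3 : dot w (z - u) = dot (grad u) (z - u) + e * dot u (z - u).
  by rewrite dotDl dotZl.
have h4 : 0 <= `|w| ^+ 2 + 2 * (e * dot w (z - u)) + e ^+ 2 * `|z - u| ^+ 2.
  rewrite -dotZr -[e ^+ 2](real_normK (num_real e)) -exprMn -normrZ.
  by rewrite -(sqr_normD dotE) sqr_ge0.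
move: h1 h2 h3 h4; rewrite /regularized.
move: (dot (grad u) (z - u)) (dot u (z - u)) (dot w (z - u)) => p q r.
move: (`|w| ^+ 2 : R) (`|z - u| ^+ 2 : R) (`|u| ^+ 2 : R) (`|z| ^+ 2 : R) => W D U Z.
move: (f u) (f z) => fu fz h1 -> h3 h4; rewrite h3 in h4.
have h5 : e * (fu - fz) <= e * - p by rewrite ler_pM2l//; lra.
lra.
Qed.

Variables (c : R) (beta : R -> R) (x : R -> H).
Hypothesis c_gt0 : 0 < c.

(** The Lyapunov function: the gap to the minimum of the regularized function is
    of order [1 / beta], hence the factor [beta]. *)
Definition energy t : R :=
  let e := c / beta t in beta t * (phi e (x t) - phi e (y e)).

Lemma energy_ge0 t : 0 < beta t -> 0 <= energy t.
Proof.
move=> b0; rewrite /energy /= mulr_ge0 ?(ltW b0)// subr_ge0.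
by apply: (regularized_argminP dotE f_convex f_diff z0_min); rewrite divr_gt0.
Qed.

Lemma energy_growth t : 0 < beta t ->
  `|x t - y (c / beta t)| ^+ 2 <= 4 / c * energy t.
Proof.
move=> b0; have e0 : 0 < c / beta t by rewrite divr_gt0.
have := regularized_growth dotE f_convex f_diff z0_min (x t) e0 => h.
have cb : 0 < 4 / c * beta t by rewrite mulr_gt0// divr_gt0.
rewrite /energy /= mulrA; apply: le_trans (ler_wpM2l (ltW cb) h).
by rewrite le_eqVlt; apply/orP; left; apply/eqP; field; rewrite !gt_eqF.
Qed.

Lemma is_derive_energy (dbeta : R) (dx : H) t : 0 < beta t ->
  is_derive t 1 beta dbeta -> is_derive t 1 x dx ->
  is_derive t 1 energy
    (dbeta / beta t * energy t +
     beta t * dot (grad (x t) + (c / beta t) *: x t) dx +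
     c * (dbeta / beta t) / 2 * (`|y (c / beta t)| ^+ 2 - `|x t| ^+ 2)).
Proof.
move=> b0 db dx'.
have e0 : 0 < c / beta t by rewrite divr_gt0.
have bn : beta t != 0 by rewrite gt_eqF.
have deps : is_derive t 1 (fun s => c / beta s : R) (- (c * dbeta) / beta t ^+ 2 : R).
  apply: (is_derive_eq (is_derive_div_fun bn (is_derive_cst (c : R) t (1 : R)) db)).
  by rewrite /cst mul0r sub0r mulNr.
have dV := is_derive_regularized_min dotE f_convex f_diff z0_min e0.
have dV' := @is_derive1_comp R (fun e => phi e (y e)) (fun s => c / beta s) _ _ _ dV deps.
have dn := is_derive_sqr_norm dx'.
have df := is_derive_comp_gradient dx'.
have dphi := is_deriveD_fun df (is_deriveM_fun
  (is_deriveM_fun deps (is_derive_cst (2^-1 : R) t (1 : R))) dn).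
have dG := is_deriveM_fun db (is_deriveB_fun dphi dV').
apply: (is_derive_eq dG).
rewrite dotDl dotZl /energy /cst/= /regularized.
move: (dot (grad (x t)) dx) (dot (x t) dx) => p q.
move: (`|x t| ^+ 2 : R) (`|y (c / beta t)| ^+ 2 : R) => X Y.
move: (f (x t)) (f (y (c / beta t))) => fx fy.
by move: (beta t) bn => b bn; field.
Qed.

(** Along the flow, [x' = - beta * grad (phi e)], so that the dissipation beats
    the growth [beta' / beta] of the weight; letting the parameter vary costs
    only the difference of squared norms. *)
Lemma energy_decay (dbeta : R) (dx : H) t : 0 < beta t ->
  dx + beta t *: grad (x t) + c *: x t = 0 ->
  let r := dbeta / beta t in
  r * energy t + beta t * dot (grad (x t) + (c / beta t) *: x t) dx +
    c * r / 2 * (`|y (c / beta t)| ^+ 2 - `|x t| ^+ 2) <=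
  - (2 * c - r) * energy t +
    c * r / 2 * (`|y (c / beta t)| ^+ 2 - `|x t| ^+ 2).
Proof.
move=> b0 ode /=; set r := dbeta / beta t; have e0 : 0 < c / beta t by rewrite divr_gt0.
set w := grad (x t) + (c / beta t) *: x t.
have -> : dx = - (beta t *: w).
  apply/eqP; rewrite -addr_eq0 /w scalerDr scalerA mulrCA mulfV ?gt_eqF// mulr1.
  by rewrite addrA ode.
rewrite lerD2r dotNr dotZr dotE.
have := regularized_gradient_ge (x t) (y (c / beta t)) e0; rewrite -/w => h.
suff : 2 * c * energy t <= beta t * (beta t * `|w| ^+ 2) by lra.
have -> : 2 * c * energy t = beta t * (beta t *
    (2 * (c / beta t) * (phi (c / beta t) (x t) - phi (c / beta t) (y (c / beta t))))).
  by rewrite /energy /=; field; rewrite gt_eqF.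
by rewrite !ler_pM2l.
Qed.

End Dynamics.

(** * Growth of the weight and decay of the energy *)

Section Growth.
Context {R : realType}.
Variables (a mu : R) (beta dbeta ddbeta : R -> R).
Hypothesis mu_gt0 : 0 < mu.
Hypothesis beta_gt0 : forall t, a < t -> 0 < beta t.
Hypothesis dbeta_neq0 : forall t, a < t -> dbeta t != 0.
Hypothesis beta_der : forall t, a < t -> is_derive t 1 beta (dbeta t).
Hypothesis dbeta_der : forall t, a < t -> is_derive t 1 dbeta (ddbeta t).
Hypothesis ddbeta_cont : forall t, a < t -> {for t, continuous ddbeta}.
Hypothesis beta_pinfty : beta t @[t --> +oo] --> +oo.

(* [excess] is [mu] plus the logarithmic derivative of [rate]. *)
Let rate t := dbeta t / beta t.
Let excess t := mu + ddbeta t / dbeta t - dbeta t / beta t.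

Lemma not_bounded_pinfty s B : ~ (forall t, s <= t -> beta t <= B).
Proof.
move=> bd; have [t [st]] : exists t, s <= t /\ B < beta t.
  near (pinfty_nbhs R) => t; exists t; split.
    by near: t; exact: nbhs_pinfty_ge (num_real _).
  by near: t; move/cvgryPgt : beta_pinfty; exact.
by rewrite ltNge bd.
Unshelve. all: by end_near. Qed.

(** A nonvanishing continuous derivative has a constant sign, and a negative one
    would keep [beta] bounded. *)
Lemma dbeta_gt0 t : a < t -> 0 < dbeta t.
Proof.
move=> at_; rewrite lt0r dbeta_neq0//= leNgt; apply/negP => neg.
apply: (@not_bounded_pinfty t (beta t)) => s ts.
apply: (derive_le0_nincr beta_der _ at_ ts) => r ar; apply: ltW.
apply: (continuous_avoid_lt _ dbeta_neq0 at_ ar neg) => q aq.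
exact: is_derive_continuous (dbeta_der aq).
Qed.

Lemma rate_gt0 t : a < t -> 0 < rate t.
Proof. by move=> at_; rewrite divr_gt0 ?dbeta_gt0 ?beta_gt0. Qed.

Lemma is_derive_rate t : a < t -> is_derive t 1 rate (rate t * (excess t - mu)).
Proof.
move=> at_; have bn : beta t != 0 by rewrite gt_eqF// beta_gt0.
have dn := dbeta_neq0 at_.
apply: (is_derive_eq (is_derive_div_fun bn (dbeta_der at_) (beta_der at_))).
by rewrite /rate /excess; field; rewrite bn dn.
Qed.

Lemma excess_continuous t : a < t -> {for t, continuous excess}.
Proof.
move=> at_; have bn : beta t != 0 by rewrite gt_eqF// beta_gt0.
have dn := dbeta_neq0 at_.
have cb := is_derive_continuous (beta_der at_).
have cd := is_derive_continuous (dbeta_der at_).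
apply: cvgB; first apply: cvgD; first exact: cvg_cst.
- by apply: cvgM; [exact: ddbeta_cont|exact: cvgV].
- by apply: cvgM => //; exact: cvgV.
Qed.

(** If the excess stayed nonpositive, [rate] would decay exponentially and
    [ln beta], whose derivative it is, would remain bounded. *)
Lemma excess_pos_somewhere s : a < s -> ~ (forall t, s < t -> excess t <= 0).
Proof.
move=> as_ neg; pose s' := s + 1; have ss' : s < s' by rewrite ltrDl.
have as' := lt_trans as_ ss'.
have dec t : s' <= t -> expR (mu * t) * rate t <= expR (mu * s') * rate s'.
  move=> s't; pose u t := expR (mu * t) * rate t.
  have du q : s < q -> is_derive q 1 u (expR (mu * q) * (rate q * excess q)).
    move=> sq; apply: (is_derive_eq (is_deriveM_fun (is_derive_expRM mu q)
      (is_derive_rate (lt_trans as_ sq)))); ring.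
  apply: (derive_le0_nincr du) => // q sq.
  rewrite pmulr_rle0 ?expR_gt0// pmulr_rle0 ?neg// rate_gt0//.
  exact: lt_trans sq.
set A := expR (mu * s') * rate s' in dec.
pose u t := ln (beta t) + A / mu * expR ((- mu) * t).
have du t : s' < t -> is_derive t 1 u (rate t - A * expR (- mu * t)).
  move=> s't; have at_ := lt_trans as' s't.
  have dl := is_derive1_comp (is_derive1_ln (beta_gt0 at_)) (beta_der at_).
  apply: (is_derive_eq (is_deriveD_fun dl (is_deriveZ_fun (A / mu)
    (is_derive_expRM (- mu) t)))).
  by rewrite /rate mulrC; field; rewrite !gt_eqF// beta_gt0.
have udec t : s' + 1 <= t -> u t <= u (s' + 1).
  apply: (derive_le0_nincr du) => [q s'q|]; last by rewrite ltrDl.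
  rewrite subr_le0 -(ler_pM2l (expR_gt0 (mu * q))) [leRHS]mulrCA -expRD.
  by rewrite mulNr subrr expR0 mulr1 dec// ltW.
have A0 : 0 <= A by rewrite mulr_ge0 ?expR_ge0// ltW// rate_gt0.
apply: (@not_bounded_pinfty (s' + 1) (expR (u (s' + 1)))) => t s't.
have at_ : a < t by rewrite (lt_le_trans _ s't)// ltr_wpDr.
rewrite -[beta t]lnK ?posrE ?beta_gt0// ler_expR (le_trans _ (udec t s't))//.
by rewrite lerDl mulr_ge0 ?expR_ge0// divr_ge0// ltW.
Qed.

(** The limsup bound keeps [excess] from taking small positive values, since
    the numerator exceeds 1; by continuity [excess] then lies on one side
    of this gap, and it cannot be the nonpositive one. *)
Lemma excess_bounded_below M :
  (\forall t \near +oo, (1 + rate t) / excess t <= M) ->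
  exists K T, [/\ 0 < K, a < T & forall t, T < t -> 1 <= K * excess t].
Proof.
move=> [T0 [_ ratioM]]; pose K := Num.max M 1; pose T := Num.max T0 (a + 1).
have K0 : 0 < K by rewrite lt_max ltr01 orbT.
have aT : a < T by rewrite lt_max ltrDl ltr01 orbT.
have aTt t : T < t -> a < t by exact: lt_trans.
have gap t : T < t -> 0 < excess t -> 1 <= K * excess t.
  move=> Tt e0; have : (1 + rate t) / excess t <= K.
    rewrite le_max ratioM//; move: Tt; rewrite /T gt_max => /andP[]//.
  rewrite ler_pdivrMr//; apply: le_trans; rewrite lerDl ltW// rate_gt0//.
  exact: aTt.
exists K, T; split=> // t Tt; apply: (gap) => //; rewrite ltNge; apply/negP => et.
have v0 : 0 < (2 * K)^-1 by rewrite invr_gt0 mulr_gt0.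
have avoid q : T < q -> excess q != (2 * K)^-1.
  move=> Tq; apply/eqP => eq; have := gap q Tq; rewrite eq => /(_ v0).
  by rewrite invfM mulrCA mulfV ?gt_eqF//; lra.
have below q : T < q -> excess q < (2 * K)^-1.
  move=> Tq; apply: (@continuous_avoid_lt _ excess T _ _ avoid t) => //.
    by move=> p /aTt; exact: excess_continuous.
  exact: le_lt_trans et v0.
apply: (@excess_pos_somewhere T aT) => q Tq; rewrite leNgt; apply/negP => e0.
have := gap q Tq e0; have := below q Tq; rewrite -(ltr_pM2l K0) invfM.
by rewrite mulrCA mulfV ?gt_eqF//; lra.
Qed.

End Growth.

Section Decay.
Context {R : realType}.
Variables (a k : R) (G dG : R -> R).
Hypothesis k_gt0 : 0 < k.
Hypothesis G_der : forall t, a < t -> is_derive t 1 G (dG t).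

Lemma expR_decay s B e : 0 < e ->
  \forall t \near +oo, expR (- (k * (t - s))) * B <= e.
Proof.
move=> e0; near=> t.
have ts : 0 <= t - s by rewrite subr_ge0; near: t; exact: nbhs_pinfty_ge (num_real _).
have kts : `|B| <= e * (1 + k * (t - s)).
  have : s + `|B| / (e * k) <= t by near: t; exact: nbhs_pinfty_ge (num_real _).
  rewrite addrC -lerBrDr ler_pdivrMr ?mulr_gt0// => h.
  by apply: (le_trans h); lra.
rewrite expRN mulrC ler_pdivrMr ?expR_gt0//.
apply: le_trans (ler_norm _) _; apply: (le_trans kts).
by rewrite ler_wpM2l// ?expR_ge1Dx// ltW.
Unshelve. all: by end_near. Qed.

Lemma decay_bounded s b : a < s -> 0 <= b ->
  (forall t, a < t -> dG t <= - k * G t + b) ->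
  exists B, 0 < B /\ forall t, s <= t -> G t <= B.
Proof.
move=> as_ b0 le; exists (b / k + `|G s - b / k| + 1); split.
  by rewrite ltr_wpDl// addr_ge0// divr_ge0// ltW.
move=> t st; apply: le_trans (gronwall_exp k_gt0 G_der le as_ st) _.
rewrite -addrA lerD2l ler_wpDr//; apply: le_trans (ler_norm _) _.
rewrite normrM ger0_norm ?expR_ge0// ler_piMl// -expR0 ler_expR oppr_le0.
by rewrite mulr_ge0 ?subr_ge0// ltW.
Qed.

Lemma decay_cvg0 :
  (forall e, 0 < e -> \forall t \near +oo, dG t <= - k * G t + e) ->
  forall e, 0 < e -> \forall t \near +oo, G t <= e.
Proof.
move=> le e e0.
have ke : 0 < k * (e / 2) by rewrite mulr_gt0// divr_gt0.
have [T0 [_ hT]] := le _ ke.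
pose T := Num.max T0 a; pose s := T + 1.
have Ts : T < s by rewrite ltrDl.
have dT t : T < t -> is_derive t 1 G (dG t).
  by rewrite gt_max => /andP[_]; exact: G_der.
have lT t : T < t -> dG t <= - k * G t + k * (e / 2).
  by rewrite gt_max => /andP[/hT].
have e2 : 0 < e / 2 by rewrite divr_gt0.
near=> t; have st : s <= t by near: t; exact: nbhs_pinfty_ge (num_real _).
apply: le_trans (gronwall_exp k_gt0 dT lT Ts st) _.
rewrite mulrAC mulfV ?gt_eqF// mul1r [leRHS](splitr e) lerD2l.
by near: t; exact: expR_decay.
Unshelve. all: by end_near. Qed.

(** The excess turns the forcing [r] into a multiple of the derivative of
    [expR (k * t) * r t], so that it can be integrated exactly. *)
Lemma decay_rate (r excess : R -> R) K0 K :
  (forall t, a < t -> is_derive t 1 r (r t * (excess t - k))) ->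
  (forall t, a < t -> 0 < r t) -> 0 <= K0 -> 0 < K ->
  (forall t, a < t -> 1 <= K * excess t) ->
  (forall t, a < t -> dG t <= - k * G t + K0 * r t) ->
  forall s, a < s ->
  exists2 C, 0 < C & forall t, s <= t -> G t <= C * ((expR (k * t))^-1 + r t).
Proof.
move=> dr r0 K00 Kpos eK le s as_.
pose u t := expR (k * t) * (G t - K0 * K * r t).
have du t : a < t -> is_derive t 1 u
    (expR (k * t) * (dG t + k * G t - K0 * K * (r t * excess t))).
  move=> at_; apply: (is_derive_eq (is_deriveM_fun (is_derive_expRM k t)
    (is_deriveB_fun (G_der at_) (is_deriveZ_fun (K0 * K) (dr t at_))))); ring.
have udec t : s <= t -> u t <= u s.
  apply: (derive_le0_nincr du) => // q aq; rewrite pmulr_rle0 ?expR_gt0//.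
  have := le q aq; have : K0 * r q * 1 <= K0 * r q * (K * excess q).
    by rewrite ler_wpM2l ?eK// mulr_ge0// ltW// r0.
  lra.
exists (`|u s| + K0 * K + 1); first by rewrite ltr_wpDl// addr_ge0// mulr_ge0// ltW.
move=> t st; have at_ := lt_le_trans as_ st.
have e0 := expR_gt0 (k * t); have ei0 : 0 < (expR (k * t))^-1 by rewrite invr_gt0.
have h1 : G t - K0 * K * r t <= `|u s| * (expR (k * t))^-1.
  by rewrite ler_pdivlMr// mulrC (le_trans (udec t st))// ler_norm.
have h2 := r0 t at_; have h3 := normr_ge0 (u s).
have h4 : 0 <= K0 * K by rewrite mulr_ge0// ltW.
have h5 := mulr_ge0 h3 (ltW h2); have h6 := mulr_ge0 h4 (ltW ei0); lra.
Qed.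

End Decay.

(** * Convergence of the trajectory *)

Theorem theorem2p1 (R : realType) (H : completeNormedModType R)
    (dot : {dot H for (idfun : R -> R)}) (dotE : is_inner_product dot)
    (f : H -> R)
    (f_convex : convex_function (setT : set (convex_lmodType H)) f)
    (f_diff : forall x : H, differentiable f x)
    (S_neq0 : argmin setT f !=set0)
    (grad_lip : forall B : set H, bounded_set B ->
      [lipschitz gradient dot f x | x in B])
    (c t0 : R) (c_gt0 : 0 < c) (t0_gt0 : 0 < t0)
    (beta : R -> R)
    (dbeta := derive_on `[t0, +oo[ beta)
    (ddbeta := derive_on `[t0, +oo[ dbeta)
    (beta_gt0 : forall t, t0 <= t -> 0 < beta t)
    (beta_C2 : C2_on `[t0, +oo[ beta)
    (dbeta_neq0 : forall t, t0 <= t -> dbeta t != 0)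
    (beta_pinfty : beta t @[t --> +oo] --> +oo)
    (mu : R) (mu_gt0 : 0 < mu)
    (beta_growth : forall t, t0 < t ->
      Num.max (dbeta t / beta t) 1 <= c - mu)
    (beta_limsup :
      (limf_esup (fun t : R =>
         ((1 + dbeta t / beta t) /
          (mu + ddbeta t / dbeta t - dbeta t / beta t))%:E) (+oo)%R < +oo)%E)
    (x : R -> H)
    (x_derivable : forall t, t0 <= t -> derivable_on `[t0, +oo[ x t)
    (x_sol : forall t, t0 <= t ->
      derive_on `[t0, +oo[ x t + beta t *: gradient dot f (x t) + c *: x t
        = 0) :
  (exists xstar : H,
     argmin (argmin setT f) (fun z : H => `|z|) = [set xstar] /\
     x t @[t --> +oo] --> xstar) /\
  (exists2 t1 : R, t0 <= t1 &
    [/\ bigO_from t1 (fun t => f (x t) - inf (range f))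
          (fun t => (beta t)^-1),
        bigO_from t1 (fun t => `|x t - tikhonov_path f c beta t| ^+ 2)
          (fun t => (expR (mu * t))^-1 + dbeta t / beta t) &
        bigO_from t1 (fun t => `|gradient dot f (x t)| ^+ 2)
          (fun t => (beta t)^-1)]).
Proof.
have [z0 [_ z0min]] := S_neq0.
have [xstar [xs_min xs_norm xs_cvg]] : exists z, [/\ forall u, f z <= f u,
    forall u, (forall v, f u <= f v) -> `|z| <= `|u| &
    regularized_argmin f e @[e --> 0^'+] --> z].
  by apply: (regularized_argmin_cvg dotE f_convex f_diff (z0 := z0)) => z; exact: z0min.
set y := regularized_argmin f in xs_cvg *.
pose r t := dbeta t / beta t.
pose excess t := mu + ddbeta t / dbeta t - dbeta t / beta t.
pose G := energy f c beta x.
have pathE t : tikhonov_path f c beta t = y (c / beta t).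
  rewrite /tikhonov_path /y /regularized_argmin; congr (get (argmin _ _)).
  apply/funext => z; rewrite /tikhonov /regularized.
  by rewrite (_ : c / (2 * beta t) = c / beta t / 2)// invfM mulrA mulrAC.
have b_gt0 t : t0 < t -> 0 < beta t by move=> /ltW; exact: beta_gt0.
have db_neq0 t : t0 < t -> dbeta t != 0 by move=> /ltW; exact: dbeta_neq0.
have [bd1 bd2 bc] := beta_C2.
have inD t : t0 < t -> `[t0, +oo[%classic t by move=> h; rewrite /= in_itv/= andbT ltW.
have b_der t : t0 < t -> is_derive t 1 beta (dbeta t).
  by move=> h; apply: derive_on_interior => //; apply: bd1; exact: inD.
have db_der t : t0 < t -> is_derive t 1 dbeta (ddbeta t).
  by move=> h; apply: derive_on_interior => //; apply: bd2; exact: inD.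
have ddb_cont t : t0 < t -> {for t, continuous ddbeta}.
  move=> h; have [cin _] := (continuous_within_itvcyP t0 ddbeta).1 bc.
  by apply: cin; rewrite in_itv/= andbT.
have x_der t : t0 < t -> is_derive t 1 x (derive_on `[t0, +oo[ x t).
  by move=> h; apply: derive_on_interior => //; apply: x_derivable; exact: ltW.
have r_gt0 t : t0 < t -> 0 < r t.
  exact: (rate_gt0 b_gt0 db_neq0 b_der db_der beta_pinfty).
have r_der t : t0 < t -> is_derive t 1 r (r t * (excess t - mu)).
  exact: (is_derive_rate mu b_gt0 db_neq0 b_der db_der).
have r_le t : t0 < t -> r t <= c - mu /\ 1 <= c - mu.
  by move=> /beta_growth; rewrite ge_max => /andP[].
have cmu : 1 <= c - mu by have [] := r_le (t0 + 1) (ltr_pwDr ltr01 (lexx t0)).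
(* The limit superior condition becomes [1 <= K * excess t] for [t > T]. *)
have [M ratioM] := limf_esup_lt_pinfty beta_limsup.
have [K [T [K0 t0T excK]]] := excess_bounded_below mu_gt0 b_gt0 db_neq0 b_der db_der
  ddb_cont beta_pinfty ratioM.
have Tt t : T < t -> t0 < t by exact: lt_trans.
pose N := `|xstar| ^+ 2.
have y_le t : t0 < t -> `|y (c / beta t)| ^+ 2 <= N.
  move=> h; apply: (norm_regularized_argmin_le dotE f_convex f_diff xs_min) => //.
  by rewrite divr_gt0// b_gt0.
have G_ge0 t : t0 < t -> 0 <= G t.
  by move=> h; apply: (energy_ge0 dotE f_convex f_diff xs_min _ c_gt0); exact: b_gt0.
pose defect t := `|y (c / beta t)| ^+ 2 - `|x t| ^+ 2.
(* The decay rate [2 * c - r t] of the energy is at least [c + mu], because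
   [r t <= c - mu]. *)
have [dG G_der dG_le] : exists2 dG : R -> R, (forall t, t0 < t -> is_derive t 1 G (dG t)) &
    forall t, t0 < t -> dG t <= - (c + mu) * G t + c * r t / 2 * defect t.
  pose dx := derive_on `[t0, +oo[ x.
  exists (fun t => r t * G t +
    beta t * dot (gradient dot f (x t) + (c / beta t) *: x t) (dx t) +
    c * r t / 2 * defect t) => t h.
    exact: (is_derive_energy dotE f_convex f_diff xs_min c_gt0 (b_gt0 t h) (b_der t h)
      (x_der t h)).
  have := energy_decay dotE f_convex f_diff c_gt0 (dbeta t) (b_gt0 t h) (x_sol t (ltW h)).
  move=> /= /le_trans; apply; rewrite lerD2r -/(r t) ler_wpM2r ?G_ge0//.
  by have [] := r_le t h; lra.
have cmu0 : 0 < c + mu by lra.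
have cr t : t0 < t -> 0 <= c * r t / 2 <= c * (c - mu) / 2.
  move=> h; have := r_gt0 t h; have [rl _] := r_le t h => r0.
  apply/andP; split; first by rewrite divr_ge0// mulr_ge0// ltW.
  by rewrite ler_pM2r ?invr_gt0// ler_pM2l.
have N0 : 0 <= N by rewrite sqr_ge0.
have forcing t : t0 < t -> c * r t / 2 * defect t <= c * N / 2 * r t.
  move=> h; have /andP[cr0 _] := cr t h.
  have d : defect t <= N by have := y_le t h; rewrite /defect; have := sqr_ge0 `|x t|; lra.
  by have := ler_wpM2l cr0 d; lra.
have [B [B0 GB]] : exists B, 0 < B /\ forall t, T + 1 <= t -> G t <= B.
  apply: (decay_bounded cmu0 G_der (b := c * (c - mu) / 2 * N)) => //.
  - by rewrite (lt_trans t0T)// ltrDl.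
  - by rewrite mulr_ge0// divr_ge0// mulr_ge0//; lra.
  - move=> t h; apply: le_trans (dG_le t h) _; rewrite lerD2l.
    apply: le_trans (forcing t h) _.
    by have /andP[_ h2] := cr t h; have := ler_wpM2r N0 h2; lra.
have t1t t : T + 1 <= t -> t0 < t.
  by move=> h; rewrite (lt_le_trans _ h)// (lt_trans t0T)// ltrDl.
(* Passing from [regularized f e] back to [f] costs [e / 2 * N], which is also of
   order [1 / beta t]. *)
have f_gap t : T + 1 <= t -> f (x t) - f xstar <= (B + c * N / 2) * (beta t)^-1.
  move=> h; have b0 := b_gt0 t (t1t t h).
  have e0 : 0 < c / beta t by rewrite divr_gt0.
  have := regularized_argminP dotE f_convex f_diff xs_min e0 xstar.
  have := GB t h; rewrite /G /energy /= -/y.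
  set e := c / beta t in e0 *; move: (regularized f e (y e)) => P.
  rewrite /regularized -/N => h1 h2.
  have be : beta t * e = c by rewrite /e mulrCA mulfV ?gt_eqF// mulr1.
  have hX : beta t * (e / 2 * `|x t| ^+ 2) = c / 2 * `|x t| ^+ 2 by rewrite -be; ring.
  have hN : beta t * (e / 2 * N) = c / 2 * N by rewrite -be; ring.
  have h3 : 0 <= c / 2 * `|x t| ^+ 2 by rewrite mulr_ge0 ?sqr_ge0// divr_ge0// ltW.
  have := ler_wpM2l (ltW b0) h2; rewrite mulrDr hN => h4.
  by rewrite ler_pdivlMr// mulrC mulrBr; move: h1; rewrite mulrBr mulrDr hX; lra.
have x_near t : T + 1 <= t -> `|x t - y (c / beta t)| ^+ 2 <= 4 / c * G t.
  move=> h; apply: (energy_growth dotE f_convex f_diff xs_min _ c_gt0).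
  exact: b_gt0 (t1t t h).
have c4 : 0 < 4 / c by rewrite divr_gt0.
have infE : inf (range f) = f xstar.
  apply/eqP; rewrite eq_le; apply/andP; split.
    by apply: ge_inf; [exists (f xstar) => _ [z _ <-]|exists xstar].
  by apply: lb_le_inf; [exists (f xstar), xstar|move=> _ [z _ <-]].
have GC : 0 < B + c * N / 2 by rewrite ltr_pwDl// divr_ge0// mulr_ge0// ltW.
split; last first.
  exists (T + 1); first by rewrite ltW// t1t.
  split.
  - by exists (B + c * N / 2) => // t h; rewrite infE f_gap.
  - have [] := @decay_rate _ T mu G dG (fun t h => G_der t (Tt t h)) r excess (c * N / 2) K
      (fun t h => r_der t (Tt t h)) (fun t h => r_gt0 t (Tt t h)) _ K0 excK _ (T + 1).
    + by rewrite divr_ge0// mulr_ge0// ltW.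
    + move=> t h; have h' := Tt t h; apply: le_trans (dG_le t h') _.
      apply: lerD (forcing t h'); rewrite ler_wpM2r ?G_ge0//; lra.
    + by rewrite ltrDl.
    move=> C C0 GC'; exists (4 / c * C); first by rewrite mulr_gt0.
    move=> t h; rewrite pathE (le_trans (x_near t h))// -[leRHS]mulrA ler_pM2l//.
    exact: GC'.
  - pose rho := 1 + 4 / c * B + `|xstar|.
    have [L L0 gL] := sqr_gradient_le_on_ball dotE f_convex f_diff grad_lip rho xs_min.
    exists (L * (B + c * N / 2)); first by rewrite mulr_gt0.
    (* [v <= 1 + v^2] bounds the distance to the path by its square. *)
    move=> t h; have xrho : `|x t| <= rho.
      have -> : x t = (x t - y (c / beta t)) + y (c / beta t) by rewrite subrK.
      apply: le_trans (ler_normD _ _) _; apply: lerD.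
        have h1 : `|x t - y (c / beta t)| ^+ 2 <= 4 / c * B.
          by rewrite (le_trans (x_near t h))// ler_pM2l// GB.
        move: (4 / c * B) `|x t - y (c / beta t)| h1 => Z v h1.
        have := sqr_ge0 (v - 1); have := sqr_ge0 v; lra.
      by have := y_le t (t1t t h); rewrite /N ler_pXn2r ?nnegrE.
    by apply: le_trans (gL _ xrho) _; rewrite -[leRHS]mulrA ler_pM2l// f_gap.
exists xstar; split.
  apply/seteqP; split => z /=.
    move=> [[_ zmin] zn]; apply/esym.
    apply: (min_norm_unique dotE f_convex (u := xstar) (v := z)) => //.
      by move=> w; exact: zmin.
    by apply: zn; split.
  move=> ->; split; first by split.
  by move=> u [_ umin]; apply: xs_norm => v; exact: umin.
have inv_beta_small k e : 0 < k -> 0 < e -> \forall t \near +oo, k * (beta t)^-1 <= e.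
  move=> k0 e0; near=> t.
  have b0 : 0 < beta t.
    by apply: b_gt0; near: t; exact: nbhs_pinfty_gt (num_real _).
  rewrite ler_pdivrMr// mulrC -ler_pdivrMr//.
  by near: t; move/cvgryPge : beta_pinfty; exact.
have eps_cvg : c / beta t @[t --> +oo] --> 0^'+.
  have eps0 : c / beta t @[t --> +oo] --> (0 : R).
    apply/cvgrPdist_le => e e0; near=> t.
    have b0 : 0 < beta t.
      by apply: b_gt0; near: t; exact: nbhs_pinfty_gt (num_real _).
    rewrite sub0r normrN gtr0_norm ?divr_gt0//.
    by near: t; exact: inv_beta_small.
  move=> A A0; suff : \forall t \near +oo, A (c / beta t) by [].
  have : \forall t \near +oo, 0 < c / beta t -> A (c / beta t) := eps0 _ A0.
  apply: filter_app; near=> t; apply.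
  have b0 : 0 < beta t.
    by apply: b_gt0; near: t; exact: nbhs_pinfty_gt (num_real _).
  exact: divr_gt0.
have y_cvg : y (c / beta t) @[t --> +oo] --> xstar by exact: (cvg_comp _ _ eps_cvg xs_cvg).
(* Testing the minimality of [y d], for a fixed
   small [d], against [x t] bounds [|x t|^2] below by [|y d|^2] up to a multiple
   of [f (x t) - f xstar], which tends to 0. *)
have defect_small e : 0 < e -> \forall t \near +oo, defect t <= e.
  move=> e0; have sq_cvg := cvg_comp _ _ xs_cvg (@continuous_sqr_norm _ _ xstar).
  have [d d0 yd] : exists2 d : R, 0 < d & N - e / 2 <= `|y d| ^+ 2.
    near (0 : R)^'+ => d; exists d => //; near: d.
    by apply: (cvgr_ge _ sq_cvg); rewrite ltrBlDr ltrDl divr_gt0.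
  have de0 : 0 < d * e / 4 by rewrite divr_gt0// mulr_gt0.
  near=> t; have h : T + 1 <= t by near: t; exact: nbhs_pinfty_ge (num_real _).
  have := f_gap t h => h1.
  have h2 : (B + c * N / 2) * (beta t)^-1 <= d * e / 4 by near: t; exact: inv_beta_small.
  have := regularized_argminP dotE f_convex f_diff xs_min d0 (x t).
  rewrite -/y /regularized => h3; have h4 := xs_min (y d).
  have h5 : d * (N - e / 2) <= d * `|y d| ^+ 2 by rewrite ler_pM2l.
  have h6 : d * (N - e) <= d * `|x t| ^+ 2 by lra.
  by move: h6; rewrite ler_pM2l// /defect => h6; have := y_le t (t1t t h); lra.
have G_small : forall e, 0 < e -> \forall t \near +oo, G t <= e.
  apply: (decay_cvg0 cmu0 G_der) => e e0.
  pose A := c * (c - mu) / 2; have A0 : 0 < A by rewrite divr_gt0// mulr_gt0//; lra.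
  near=> t; have h : t0 < t by near: t; exact: nbhs_pinfty_gt (num_real _).
  have small : defect t <= e / A by near: t; apply: defect_small; rewrite divr_gt0.
  apply: le_trans (dG_le t h) _; rewrite lerD2l.
  have /andP[cr0 crA] := cr t h.
  apply: le_trans (ler_wpM2l cr0 small) _; rewrite mulrA ler_pdivrMr// mulrC.
  by rewrite ler_pM2l.
have diff_cvg : x t - y (c / beta t) @[t --> +oo] --> (0 : H).
  apply/cvgrPdist_le => e e0; rewrite /=.
  have e40 : 0 < e ^+ 2 / (4 / c) by rewrite divr_gt0// exprn_gt0.
  near=> t; have h : T + 1 <= t by near: t; exact: nbhs_pinfty_ge (num_real _).
  have Gs : G t <= e ^+ 2 / (4 / c) by near: t; exact: G_small.
  rewrite sub0r normrN -(@ler_pXn2r _ 2) ?nnegrE ?(ltW e0)//.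
  by rewrite (le_trans (x_near t h))// mulrC -ler_pdivlMr.
have -> : x = (fun t => (x t - y (c / beta t)) + y (c / beta t)).
  by apply/funext => t; rewrite subrK.
by rewrite -[X in _ --> X](add0r xstar); exact: cvgD.
Unshelve. all: by end_near. Qed.
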